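(* The maximum likelihood degree of the AR$(1)$ model with parameters $(\phi,\sigma^2)$ is $3$ for any sample size $n>1$. Defining the constants $$b_3=-(n-1)\sum_{i=2}^{n-1}x_i^2,\qquad b_2=(n-2)\sum_{i=1}^{n-1}x_ix_{i+1},$$ $$b_1=(n+1)\sum_{i=2}^{n-1}x_i^2+(x_1^2+x_n^2),\qquad b_0=-n\sum_{i=1}^{n-1}x_ix_{i+1},$$ the three solutions of $\phi$ are given by $$\phi_k=-\frac{b_2}{3b_3}+\frac{1}{3b_3}\left(\omega_k\sqrt[3]{U}+\omega_k^2\sqrt[3]{V}\right),\qquad k=1,2,3,$$ where $$p=\frac{3b_3b_1-b_2^2}{3b_3^2},\qquad q=\frac{2b_2^3-9b_3b_2b_1+27b_3^2b_0}{27b_3^3},$$ $$\Delta=-\left(\frac q2\right)^2-\left(\frac p3\right)^3,\qquad U=-\frac q2+\sqrt{\Delta},\qquad V=-\frac q2-\sqrt{\Delta},$$ $$\omega_1=1,\qquad \omega_2=e^{2\pi i/3}=-\tfrac12+i\tfrac{\sqrt3}{2},\qquad \omega_3=e^{4\pi i/3}=-\tfrac12-i\tfrac{\sqrt3}{2},$$ and $\sigma^2$ is then determined by $$\sigma^2=\frac1n\,\mathbf x^\top R^{-1}\mathbf x ,$$ with $R=R(\phi)$ the autocorrelation matrix of $(X_1,\dots,X_n)^\top$.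
   Context: AR$(1)$ model: $X_t=\phi X_{t-1}+Z_t$ with $Z_t$ i.i.d. $\mathcal N(0,\sigma^2)$, $t=1,\dots,n$; it is stationary, with variance $\sigma^2/(1-\phi^2)$, provided $|\phi|<1$. The observed sample is $\mathbf x=(x_1,\dots,x_n)^\top$. The covariance matrix of $(X_1,\dots,X_n)^\top$ is $\Sigma=\sigma^2R(\phi)$, where the matrix $R(\phi)$, called here the autocorrelation matrix, has entries $R_{ij}=\dfrac{\phi^{|i-j|}}{1-\phi^2}$. Its inverse $R(\phi)^{-1}$ is the tridiagonal matrix with entries $-\phi$ on the first sub- and superdiagonal and diagonal $(1,1+\phi^2,\dots,1+\phi^2,1)$. The log-likelihood (up to constants) is $$\ell(\phi,\sigma^2)=-\log\det\Sigma-\mathbf x^\top\Sigma^{-1}\mathbf x .$$ The maximum likelihood degree is the number of complex solutions $(\phi,\sigma^2)$ of the likelihood equations, obtained by setting the gradient of $\ell$ with respect to the parameters equal to zero, for generic data.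
   Formalization: Sample size is n>2 (for n=2, b_3=0 and the degree is 1); the prefactor 1/(3b_3) before the cube roots is dropped; U,V use the square root of -Δ instead of Δ; the cube roots of U and V are paired so that their product is -p/3. *)

(* Defs.v *)
From HB Require Import structures.
From mathcomp Require Import all_boot all_order all_algebra all_fingroup.
From mathcomp Require Import all_classical all_reals all_analysis.
From mathcomp Require Import complex.
From mathcomp Require mpoly.
Import (canonicals) mpoly.
From mathcomp Require Import zify.

Set Implicit Arguments.
Unset Strict Implicit.
Unset Printing Implicit Defensive.

Import Order.TTheory GRing.Theory Num.Theory numFieldNormedType.Exports.
Local Open Scope ring_scope.
Local Open Scope classical_set_scope.
Local Open Scope complex_scope.

(* The model is written over an arbitrary numFieldType K: K = R gives the     *)
(* statistical model, K = R[i] its complexification. Data are column vectors  *)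
(* indexed from 0.                                                            *)

Definition autocorr (K : numFieldType) (n : nat) (phi : K) : 'M[K]_n :=
  \matrix_(i, j) (phi ^+ `|(i : nat) - (j : nat)|%N / (1 - phi ^+ 2)).

Definition Sigma (K : numFieldType) (n : nat) (phi s : K) : 'M[K]_n :=
  s *: autocorr n phi.

Definition quad_Sigma (K : numFieldType) (n : nat) (x : 'cV[K]_n) (phi s : K)
    : K :=
  (x^T *m invmx (Sigma n phi s) *m x) 0 0.

(* [s] stands for sigma^2; it is the parameter, not its square root. *)
Definition loglik (R : realType) (n : nat) (x : 'cV[R]_n) (phi s : R) : R :=
  - ln (\det (Sigma n phi s)) - quad_Sigma x phi s.

Definition dlog (K : numFieldType) (f : K -> K) (a : K) : K :=
  derive1 f a / f a.

(* Gradient of the log-likelihood as a rational function of (phi, s). Over    *)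
(* the complex numbers log (det Sigma) is multivalued, but all its branches   *)
(* have the same derivative, namely the logarithmic derivative of det Sigma.  *)
(* For K = R the lemmas [is_derive_loglik_phi] and [is_derive_loglik_sigma2]  *)
(* below show that these are the partial derivatives of [loglik].             *)
Definition score_phi (K : numFieldType) (n : nat) (x : 'cV[K]_n) (phi s : K)
    : K :=
  - dlog (fun u => \det (Sigma n u s)) phi
  - derive1 (fun u => quad_Sigma x u s) phi.

Definition score_sigma2 (K : numFieldType) (n : nat) (x : 'cV[K]_n)
    (phi s : K) : K :=
  - dlog (fun u => \det (Sigma n phi u)) s
  - derive1 (fun u => quad_Sigma x phi u) s.

(* The side conditions describe where Sigma is defined and invertible. *)
Definition likelihood_solutions (K : numFieldType) (n : nat) (x : 'cV[K]_n)
    : set (K * K) :=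
  [set th | [/\ th.1 ^+ 2 != 1, th.2 != 0,
                score_phi x th.1 th.2 = 0 & score_sigma2 x th.1 th.2 = 0]].

(* Genericity in the sense of algebraic geometry: off a proper hypersurface. *)
Definition generic (R : realType) (n : nat) (P : 'cV[R]_n -> Prop) : Prop :=
  exists2 g : mpoly.mpoly n R, g != 0 &
    forall x : 'cV[R]_n, mpoly.meval (fun i => x i 0) g != 0 -> P x.

Definition complexify (R : realType) (n : nat) (x : 'cV[R]_n) : 'cV[R[i]]_n :=
  map_mx (fun a => a%:C) x.

Definition AR1_ml_degree_is (R : realType) (n d : nat) : Prop :=
  @generic R n (fun x => (likelihood_solutions (complexify x) #= `I_d)%card).

Section Cardano.
Context (K : numFieldType) (n : nat) (x : 'cV[K]_n).

(* 1-based access to the sample: [obs k] is x_k for 1 <= k <= n. *)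
Definition obs (k : nat) : K := oapp (fun i : 'I_n => x i 0) 0 (insub k.-1).

Definition b3 : K := - (n%:R - 1) * \sum_(2 <= i < n) obs i ^+ 2.
Definition b2 : K := (n%:R - 2) * \sum_(1 <= i < n) obs i * obs i.+1.
Definition b1 : K :=
  (n%:R + 1) * (\sum_(2 <= i < n) obs i ^+ 2) + (obs 1 ^+ 2 + obs n ^+ 2).
Definition b0 : K := - n%:R * \sum_(1 <= i < n) obs i * obs i.+1.

Definition cardano_p : K := (3 * b3 * b1 - b2 ^+ 2) / (3 * b3 ^+ 2).
Definition cardano_q : K :=
  (2 * b2 ^+ 3 - 9 * b3 * b2 * b1 + 27 * b3 ^+ 2 * b0) / (27 * b3 ^+ 3).
(* This is 1/108 of the usual discriminant - 4 p^3 - 27 q^2, hence the square *)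
(* root of its opposite in [cardano_radicals].                                *)
Definition cardano_Delta : K := - (cardano_q / 2) ^+ 2 - (cardano_p / 3) ^+ 3.

(* [d] is a square root of - Delta, [u] and [v] are cube roots of             *)
(* U = - q/2 + d and V = - q/2 - d. Over the complex numbers the cube roots   *)
(* have to be paired by u v = - p/3.                                          *)
Definition cardano_radicals (d u v : K) : Prop :=
  [/\ d ^+ 2 = - cardano_Delta,
      u ^+ 3 = - (cardano_q / 2) + d,
      v ^+ 3 = - (cardano_q / 2) - d
    & u * v = - (cardano_p / 3)].

Definition sigma2_hat (phi : K) : K :=
  n%:R^-1 * (x^T *m invmx (autocorr n phi) *m x) 0 0.

End Cardano.

Definition omega (R : realType) (k : 'I_3) : R[i] :=
  [:: 1; (- 2^-1) +i* (Num.sqrt 3 / 2); (- 2^-1) +i* (- (Num.sqrt 3 / 2))]`_k.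

Definition phi_sol (R : realType) (n : nat) (x : 'cV[R[i]]_n) (u v : R[i])
    (k : 'I_3) : R[i] :=
  - (b2 x / (3 * b3 x)) + (omega R k * u + omega R k ^+ 2 * v).

Section Gradient.

Lemma derivable_sum_seq (K : numFieldType) (I : Type) (r : seq I)
    (f : I -> K -> K) (a : K) :
  (forall i, derivable (f i) a 1) ->
  derivable (fun u => \sum_(i <- r) f i u) a 1.
Proof.
move=> df; elim: r => [|i r IHr].
  by under eq_fun do rewrite big_nil; exact: derivable_cst.
by under eq_fun do rewrite big_cons; exact: derivableD.
Qed.

Lemma derivable_prod_seq (K : numFieldType) (I : Type) (r : seq I)
    (f : I -> K -> K) (a : K) :
  (forall i, derivable (f i) a 1) ->
  derivable (fun u => \prod_(i <- r) f i u) a 1.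
Proof.
move=> df; elim: r => [|i r IHr].
  by under eq_fun do rewrite big_nil; exact: derivable_cst.
by under eq_fun do rewrite big_cons; exact: derivableM.
Qed.

Lemma derivable_det (K : numFieldType) (n : nat) (A : K -> 'M[K]_n) (a : K) :
  (forall i j, derivable (fun u => A u i j) a 1) ->
  derivable (fun u => \det (A u)) a 1.
Proof.
move=> dA; apply: derivable_sum_seq => s.
apply: derivableM; first exact: derivable_cst.
exact: derivable_prod_seq.
Qed.

Lemma derivable_quad_form (K : numFieldType) (n : nat) (A : K -> 'M[K]_n)
    (x : 'cV[K]_n) (a : K) :
  A a \in unitmx -> (forall i j, derivable (fun u => A u i j) a 1) ->
  derivable (fun u => (x^T *m invmx (A u) *m x) 0 0) a 1.
Proof.
rewrite unitmxE unitfE => nz dA; have ddet := derivable_det dA.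
have uA : \forall u \near a, A u \in unitmx.
  have /differentiable_continuous := iffLR (derivable1_diffP _ _) ddet.
  move=> /cvgr_neq0 /(_ nz); apply: filterS => u.
  by rewrite unitmxE unitfE.
pose f u := \sum_j (\sum_i x i 0 * ((\det (A u))^-1 * cofactor (A u) j i))
   * x j 0.
have Af : \forall u \near a, f u = (x^T *m invmx (A u) *m x) 0 0.
  near=> u; rewrite mxE; apply: eq_bigr => j _; rewrite mxE; congr (_ * _).
  apply: eq_bigr => i _; rewrite !mxE /invmx.
  have -> : A u \in unitmx by near: u.
  by rewrite !mxE.
apply: (near_eq_derivable Af).
apply: derivable_sum_seq => j; apply: derivableM; last exact: derivable_cst.
apply: derivable_sum_seq => i; apply: derivableM; first exact: derivable_cst.
apply: derivableM.
  exact: derivableV.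
apply: derivableM; first exact: derivable_cst.
by apply: derivable_det => k l; under eq_fun do rewrite !mxE; exact: dA.
Unshelve. all: by end_near. Qed.

Lemma det_toeplitz (K : numFieldType) (n : nat) (phi : K) :
  \det (\matrix_(i < n.+1, j < n.+1) phi ^+ `|(i : nat) - (j : nat)|%N)
  = (1 - phi ^+ 2) ^+ n.
Proof.
set M := \matrix_(i, j) _.
pose L : 'M[K]_n.+1 := \matrix_(i, j)
  ((i == j)%:R - phi * (i == j.+1 :> nat)%:R).
have detL : \det L = 1.
  rewrite det_trig; last first.
    apply/is_trig_mxP => i j ij; rewrite mxE -val_eqE /= !ltn_eqF ?mulr0 ?subr0 //.
    exact: ltnW.
  by rewrite big1 // => i _; rewrite mxE eqxx ltn_eqF // mulr0 subr0.
have LM0 j : (L *m M) ord0 j = phi ^+ j.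
  rewrite mxE (bigD1 ord0) //= big1 ?addr0 => [|k k0].
    by rewrite !mxE eqxx /= mulr0 subr0 mul1r; congr (phi ^+ _); lia.
  by rewrite !mxE eq_sym (negbTE k0) /= mulr0 subr0 mul0r.
have LMS (i j : 'I_n.+1) : (0 < i)%N ->
    (L *m M) i j = if (j < i)%N then 0 else phi ^+ (j - i) * (1 - phi ^+ 2).
  move=> i0; have i'lt : (i.-1 < n.+1)%N by rewrite prednK // ltnW.
  have ii' : i != Ordinal i'lt by rewrite -val_eqE /= gtn_eqF // ltn_predL.
  rewrite mxE (bigD1 i) //= (bigD1 (Ordinal i'lt)) /=; last by rewrite eq_sym.
  rewrite big1 ?addr0 => [|k /andP[ki ki']].
    rewrite !mxE !eqxx (negbTE ii') /= prednK // eqxx ltn_eqF // mulr0 subr0.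
    rewrite mulr1 sub0r mul1r.
    have [ji|ij] := ltnP j i.
      have -> : `|(i : nat) - (j : nat)|%N = (i - j)%N by lia.
      have -> : `|(i.-1 : nat) - (j : nat)|%N = (i.-1 - j)%N by lia.
      have -> : (i - j = (i.-1 - j).+1)%N by lia.
      by rewrite exprS mulNr subrr.
    have -> : `|(i : nat) - (j : nat)|%N = (j - i)%N by lia.
    have -> : `|(i.-1 : nat) - (j : nat)|%N = (j - i.-1)%N by lia.
    have -> : (j - i.-1 = (j - i).+1)%N by lia.
    by rewrite mulrBr mulr1 mulNr -exprS -exprD addn2.
  rewrite !mxE eq_sym (negbTE ki) /=.
  have -> : (i == k.+1 :> nat) = false.
    by apply/negbTE; move: ki'; rewrite -val_eqE /=; lia.
  by rewrite mulr0 subr0 mul0r.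
have <- : \det (L *m M) = \det M by rewrite det_mulmx detL mul1r.
rewrite -det_tr det_trig; last first.
  apply/is_trig_mxP => i j ij; rewrite mxE LMS ?ij //.
  exact: leq_ltn_trans ij.
rewrite big_ord_recl mxE LM0 expr0 mul1r.
under eq_bigr do rewrite mxE LMS // ltnn subnn expr0 mul1r.
by rewrite prodr_const card_ord.
Qed.

Lemma det_Sigma (K : numFieldType) (n : nat) (phi s : K) :
  phi ^+ 2 != 1 -> \det (Sigma n.+1 phi s) = s ^+ n.+1 / (1 - phi ^+ 2).
Proof.
move=> phi1; have nz : 1 - phi ^+ 2 != 0 by rewrite subr_eq0 eq_sym.
have -> : Sigma n.+1 phi s = (s / (1 - phi ^+ 2)) *:
    (\matrix_(i < n.+1, j < n.+1) phi ^+ `|(i : nat) - (j : nat)|%N).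
  by apply/matrixP => i j; rewrite !mxE -!mulrA [_^-1 * _]mulrC.
rewrite detZ det_toeplitz expr_div_n -mulrA; congr (_ * _).
by rewrite exprSr invfM mulrAC mulVf ?mul1r ?expf_neq0.
Qed.

Lemma derivable_Sigma_phi (K : numFieldType) (n : nat) (phi s : K) i j :
  phi ^+ 2 != 1 -> derivable (fun u => Sigma n u s i j) phi 1.
Proof.
move=> phi1; under eq_fun do rewrite !mxE.
apply: derivableM; first exact: derivable_cst.
apply: derivableM; first exact: exprn_derivable.
apply: derivableV; first by rewrite subr_eq0 eq_sym.
by apply: derivableB; [exact: derivable_cst|exact: exprn_derivable].
Qed.

Lemma derivable_Sigma_sigma2 (K : numFieldType) (n : nat) (phi s : K) i j :
  derivable (fun u => Sigma n phi u i j) s 1.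
Proof.
under eq_fun do rewrite !mxE.
by apply: derivableM; [exact: derivable_id|exact: derivable_cst].
Qed.

Lemma det_Sigma_gt0 (R : realType) (n : nat) (phi s : R) :
  `|phi| < 1 -> 0 < s -> 0 < \det (Sigma n phi s).
Proof.
move=> phi1 s0; case: n => [|n]; first by rewrite det_mx00.
have phi2 : 0 < 1 - phi ^+ 2 by rewrite subr_gt0 -real_normK ?num_real ?expr_lt1.
rewrite det_Sigma ?divr_gt0 ?exprn_gt0 //.
by rewrite eq_sym -subr_eq0 gt_eqF.
Qed.

Lemma is_derive_loglik_path (R : realType) (n : nat) (x : 'cV[R]_n)
    (A : R -> 'M[R]_n) (a : R) :
  0 < \det (A a) -> (forall i j, derivable (fun u => A u i j) a 1) ->
  is_derive a 1 (fun u => - ln (\det (A u)) - (x^T *m invmx (A u) *m x) 0 0)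
    (- dlog (fun u => \det (A u)) a
     - derive1 (fun u => (x^T *m invmx (A u) *m x) 0 0) a).
Proof.
move=> pos dA; have uA : A a \in unitmx by rewrite unitmxE unitfE gt_eqF.
have ddet := derivable_det dA; have dquad := derivable_quad_form (x := x) uA dA.
apply: is_deriveB; last by rewrite derive1E; exact/derivableP.
apply: is_deriveN; rewrite /dlog derive1E mulrC.
by apply: is_derive1_comp; [exact: is_derive1_ln|exact/derivableP].
Qed.

Lemma is_derive_loglik_phi (R : realType) (n : nat) (x : 'cV[R]_n)
    (phi s : R) :
  `|phi| < 1 -> 0 < s ->
  is_derive phi 1 (fun u => loglik x u s) (score_phi x phi s).
Proof.
move=> phi1 s0; apply: is_derive_loglik_path; first exact: det_Sigma_gt0.
move=> i j; apply: derivable_Sigma_phi.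
by rewrite -real_normK ?num_real // lt_eqF ?expr_lt1.
Qed.

Lemma is_derive_loglik_sigma2 (R : realType) (n : nat) (x : 'cV[R]_n)
    (phi s : R) :
  `|phi| < 1 -> 0 < s ->
  is_derive s 1 (fun u => loglik x phi u) (score_sigma2 x phi s).
Proof.
move=> phi1 s0; apply: is_derive_loglik_path; first exact: det_Sigma_gt0.
by move=> i j; exact: derivable_Sigma_sigma2.
Qed.

End Gradient.

(* Main.v *)
Require Import Defs.
From mathcomp Require Import all_boot all_order all_algebra.
From mathcomp Require Import all_classical all_reals all_analysis.
From mathcomp Require Import complex.
From mathcomp Require mpoly.
Import (canonicals) mpoly.
From mathcomp Require Import ring zify.
Set Implicit Arguments.
Unset Strict Implicit.
Unset Printing Implicit Defensive.
Import Order.TTheory GRing.Theory Num.Theory numFieldNormedType.Exports.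
Local Open Scope ring_scope.
Local Open Scope classical_set_scope.

(* Inverting the autocorrelation matrix gives x^T R^-1 x = Q(phi), where      *)
(* Q(phi) = A + (1 + phi^2) B - 2 phi C with A = x_1^2 + x_n^2, B the sum of  *)
(* the inner squares and C the lag-one sum. The score in sigma^2 vanishes iff *)
(* sigma^2 = Q(phi) / n; substituting this in the score in phi leaves the     *)
(* cubic phi Q(phi) + n (phi B - C) (1 - phi^2), whose coefficients are       *)
(* b_3, ..., b_0. Its roots with phi^2 = 1 or Q(phi) = 0 are spurious, and    *)
(* generic data exclude them: Q(1), Q(-1) and B (A + B) - C^2 must not        *)
(* vanish. Cardano's formula factors the cubic, and two of its roots can only *)
(* coincide if u^3 = v^3, that is if Delta = 0. All these conditions are      *)
(* polynomial in the data and hold for the second unit vector.                *)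

(** The tridiagonal inverse ([autocorr_precision]) makes both scores explicit rational functions
    ([score_phiE], [score_sigma2E]). When [nondeg] does not vanish, [likelihood_solutionsE]
    identifies the solutions with the roots of [cubic], the second coordinate being [sigma2_hat].
    [cubic_factor] and [phi_sol_inj] provide three distinct roots, and [generic_nondeg] places the
    excluded data on a proper hypersurface. For [n = 2] there are no inner observations, so [b3] is
    zero and the cubic degenerates; hence [2 < n]. *)

Lemma sum_nat_pred1 (A : pzSemiRingType) (f : nat -> A) (p k : nat) :
  \sum_(i < p) f i * (i == k :> nat)%:R = if (k < p)%N then f k else 0.
Proof.
case: ifP => kp; last first.
  rewrite big1 // => i _; case: eqP => [ik|_]; rewrite ?mulr0 //.
  by move: (ltn_ord i); rewrite ik kp.
rewrite (bigD1 (Ordinal kp)) //= eqxx mulr1 big1 ?addr0 // => i.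
by rewrite -val_eqE /= => /negbTE ->; rewrite mulr0.
Qed.

(** * The tridiagonal inverse of the autocorrelation matrix *)

Section Precision.
Context (K : numFieldType) (m : nat).
Implicit Types phi : K.

Definition precision phi : 'M[K]_m.+2 := \matrix_(i, j)
  ((1 + phi ^+ 2 * ((j != 0) && (j != ord_max))%:R) * (i == j)%:R
   - phi * (i == j.+1 :> nat)%:R - phi * (i.+1 == j :> nat)%:R).

Lemma sum_mul_precision (f : nat -> K) phi (j : 'I_m.+2) :
  \sum_(i < m.+2) f i * precision phi i j =
    (1 + phi ^+ 2 * ((j != 0) && (j != ord_max))%:R) * f j
    - phi * (if (j < m.+1)%N then f j.+1 else 0)
    - phi * (if (0 < j)%N then f j.-1 else 0).
Proof.
under eq_bigr do rewrite mxE -val_eqE /= !mulrDr !mulrN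
  [_ * (_ * (_ == _)%:R)]mulrCA [_ * (phi * (_ == _)%:R)]mulrCA
  [_ * (phi * (_ == _)%:R)]mulrCA.
rewrite !big_split !sumrN -!mulr_sumr !sum_nat_pred1 ltn_ord ltnS.
congr (_ - _ * _ - _ * _); case: (val j) (ltn_ord j) => [|k] ltkm /=.
  by rewrite big1 // => i _; rewrite mulr0.
by under eq_bigr do rewrite eqSS; rewrite sum_nat_pred1 (ltnW ltkm).
Qed.

(** Row [i] of the autocorrelation matrix is geometric on either side of [i]. The combination of
    neighbours given by a column of [precision] therefore cancels off the diagonal and leaves
    [1 - phi ^+ 2] on it, at the two ends as well. *)
Lemma autocorr_precision phi :
  phi ^+ 2 != 1 -> autocorr m.+2 phi *m precision phi = 1%:M.
Proof.
rewrite eq_sym -subr_eq0 => nz; apply/matrixP => i j; rewrite !mxE.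
pose e k := phi ^+ `|(i : nat) - k|%N.
under eq_bigr do rewrite mxE mulrAC.
rewrite -mulr_suml (sum_mul_precision e) -[in RHS](mulfK nz (_%:R)).
congr (_ / _); rewrite -!val_eqE /=.
have eS k k' : `|(i : nat) - k'|%N = `|(i : nat) - k|%N.+1 -> e k' = phi * e k.
  by rewrite /e => ->; rewrite exprS.
have im := ltn_ord i; have jm := ltn_ord j; case: (ltngtP i j) => ij.
- rewrite (_ : (0 < j)%N); last lia.
  rewrite (eS j.-1 j); last lia.
  rewrite (_ : (j != 0 :> nat)%N); last lia.
  case: ltnP => jm1.
    rewrite (_ : (j != m.+1 :> nat)); last lia.
    by rewrite (eS j j.+1) ?(eS j.-1 j) /=; [ring|lia..].
  by rewrite (_ : (j != m.+1 :> nat) = false) /=; [ring|lia].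
- rewrite (_ : (j < m.+1)%N); last lia.
  rewrite (eS j.+1 j); last lia.
  rewrite (_ : (j != m.+1 :> nat)); last lia.
  case: ltnP => j0.
    rewrite (_ : (j != 0 :> nat)%N); last lia.
    by rewrite (eS j j.-1) ?(eS j.+1 j) /=; [ring|lia..].
  by rewrite (_ : (j != 0 :> nat)%N = false) /=; [ring|lia].
- have ej : e j = 1 by rewrite /e ij (_ : `|_ - _|%N = 0%N) ?expr0 //; lia.
  case: ltnP => jm1.
    rewrite (_ : (j != m.+1 :> nat)) ?(eS j j.+1); [|lia..].
    case: ltnP => j0.
      rewrite (_ : (j != 0 :> nat)%N); last lia.
      by rewrite (eS j j.-1) ?ej /=; [ring|lia].
    by rewrite (_ : (j != 0 :> nat)%N = false) ?ej /=; [ring|lia].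
  rewrite (_ : (j != m.+1 :> nat) = false); last lia.
  rewrite (_ : (0 < j)%N); last lia.
  rewrite (eS j j.-1); last lia.
  by rewrite ej andbF /=; ring.
Qed.
End Precision.

(** * Sample statistics and the nondegeneracy polynomial *)

Section SampleStatistics.
Context (A : comNzRingType) (m : nat) (y : nat -> A).

(** The sample is a sequence in any commutative ring, so that the same formulas apply to numerical
    data and to polynomial indeterminates. *)
Definition ends : A := y 1%N ^+ 2 + y m.+2 ^+ 2.
Definition inner : A := \sum_(2 <= i < m.+2) y i ^+ 2.
Definition lag1 : A := \sum_(1 <= i < m.+2) y i * y i.+1.

Definition quad (phi : A) : A :=
  ends + (1 + phi ^+ 2) * inner - 2 * phi * lag1.

(** Unlike [cardano_Delta] this is free of divisions, hence polynomial in the data. *)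
Definition cubic_discr (a b c d : A) : A :=
  b ^+ 2 * c ^+ 2 - 4 * a * c ^+ 3 - 4 * b ^+ 3 * d - 27 * a ^+ 2 * d ^+ 2
  + 18 * a * b * c * d.

(* Up to sign, the fourth factor is a quarter of the discriminant of [quad]: *)
(* a common zero of [cubic] and [quad] other than 1 and -1 is a double root  *)
(* of [quad].                                                                *)
Definition nondeg : A :=
  inner * quad 1 * quad (-1) * (inner * (ends + inner) - lag1 ^+ 2)
  * cubic_discr (- (m.+1%:R * inner)) (m%:R * lag1)
      (m.+3%:R * inner + ends) (- (m.+2%:R * lag1)).

End SampleStatistics.

(** * The quadratic form of the inverse *)

Section QuadraticForm.
Context (K : numFieldType) (m : nat) (x : 'cV[K]_m.+2).
Implicit Types (phi s : K).

Lemma obsE (i : 'I_m.+2) : x i 0 = obs x i.+1.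
Proof. by rewrite /obs /= valK. Qed.

Lemma quad_precisionE phi :
  (x^T *m precision m phi *m x) 0 0 = quad m (obs x) phi.
Proof.
rewrite /quad; pose f k := obs x k.+1.
have -> : (x^T *m precision m phi *m x) 0 0 =
    \sum_(j < m.+2)
      (1 + phi ^+ 2 * ((j != 0) && (j != ord_max))%:R) * f j ^+ 2
    - phi * \sum_(j < m.+2) (if (j < m.+1)%N then f j * f j.+1 else 0)
    - phi * \sum_(j < m.+2) (if (0 < j)%N then f j.-1 * f j else 0).
  rewrite !mulr_sumr -!sumrB mxE; apply: eq_bigr => j _.
  rewrite mxE; under eq_bigr do rewrite mxE obsE.
  rewrite (sum_mul_precision f) obsE -/(f j).
  by case: ifP => _; case: ifP => _; ring.
have -> : lag1 m (obs x) = \sum_(i < m.+1) f i * f i.+1.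
  by rewrite /lag1 big_add1 big_mkord.
have -> : inner m (obs x) = \sum_(i < m) f i.+1 ^+ 2.
  by rewrite /inner 2!big_add1 big_mkord.
have -> : \sum_(j < m.+2) (if (j < m.+1)%N then f j * f j.+1 else 0) =
    \sum_(i < m.+1) f i * f i.+1.
  by rewrite big_ord_recr /= ltnn addr0; apply: eq_bigr => i _; rewrite ltn_ord.
have -> : \sum_(j < m.+2) (if (0 < j)%N then f j.-1 * f j else 0) =
    \sum_(i < m.+1) f i * f i.+1.
  by rewrite big_ord_recl /= add0r.
rewrite big_ord_recr big_ord_recl -!val_eqE /= !eqxx /=.
under eq_bigr => i _ do
  rewrite -!val_eqE /= /bump /= add1n eqSS (ltn_eqF (ltn_ord i)) mulr1.
by rewrite -mulr_sumr /ends -/(f 0%N) -/(f m.+1); ring.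
Qed.

Lemma invmx_autocorr phi :
  phi ^+ 2 != 1 -> invmx (autocorr m.+2 phi) = precision m phi.
Proof.
move=> /(autocorr_precision m) RT; have [uR _] := mulmx1_unit RT.
by rewrite -[RHS](mulKmx uR) RT mulmx1.
Qed.

Lemma invmx_Sigma phi s : phi ^+ 2 != 1 -> s != 0 ->
  invmx (Sigma m.+2 phi s) = s^-1 *: precision m phi.
Proof.
move=> phi1 s0; have [uR _] := mulmx1_unit (autocorr_precision m phi1).
by rewrite /Sigma invmxZ ?invmx_autocorr // unitmxZ ?unitfE.
Qed.

End QuadraticForm.

(** * Closed forms of the two scores *)

Section Score.
Context (K : numFieldType) (m : nat) (x : 'cV[K]_m.+2).
Implicit Types (phi s : K).

Lemma quad_SigmaE phi s : phi ^+ 2 != 1 -> s != 0 ->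
  quad_Sigma x phi s = s^-1 * quad m (obs x) phi.
Proof.
move=> phi1 s0.
by rewrite /quad_Sigma invmx_Sigma // -scalemxAr -scalemxAl mxE quad_precisionE.
Qed.

Lemma sigma2_hatE phi : phi ^+ 2 != 1 ->
  sigma2_hat x phi = m.+2%:R^-1 * quad m (obs x) phi.
Proof.
by move=> phi1; rewrite /sigma2_hat invmx_autocorr // quad_precisionE.
Qed.

Lemma is_derive_inv (f : K -> K) (a df : K) : f a != 0 ->
  is_derive a 1 f df -> is_derive a 1 (fun u => (f u)^-1) (- (f a) ^- 2 * df).
Proof.
move=> fa [dfa <-]; split; first exact: derivableV.
by rewrite deriveV.
Qed.

Lemma derivable_near_neq0 (f : K -> K) (a : K) :
  derivable f a 1 -> f a != 0 -> \forall u \near a, f u != 0.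
Proof.
move=> df; have /differentiable_continuous := iffLR (derivable1_diffP _ _) df.
by move=> /cvgr_neq0; apply.
Qed.

(** The closed forms of the determinant and of the inverse are available off [phi ^+ 2 = 1];
    differentiating them requires a whole neighbourhood. *)
Lemma near_sqr_neq1 phi : phi ^+ 2 != 1 -> \forall u \near phi, u ^+ 2 != 1.
Proof.
move=> phi1; have : \forall u \near phi, u ^+ 2 - 1 != 0.
  apply: derivable_near_neq0; last by rewrite subr_eq0.
  by apply: derivableB; [exact: exprn_derivable|exact: derivable_cst].
by apply: filterS => u; rewrite subr_eq0.
Qed.

Lemma near_neq0 (s : K) : s != 0 -> \forall u \near s, u != 0.
Proof. by apply: derivable_near_neq0; exact: derivable_id. Qed.

Lemma score_phiE phi s : phi ^+ 2 != 1 -> s != 0 ->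
  score_phi x phi s =
  - (2 * phi / (1 - phi ^+ 2))
  - s^-1 * (2 * phi * inner m (obs x) - 2 * lag1 m (obs x)).
Proof.
move=> phi1 s0; have nz : 1 - phi ^+ 2 != 0 by rewrite subr_eq0 eq_sym.
have near1 := near_sqr_neq1 phi1.
have ddet : is_derive phi 1 (fun u => \det (Sigma m.+2 u s))
    (s ^+ m.+2 * ((1 - phi ^+ 2) ^- 2 * (2 * phi))).
  have eq_det : \forall u \near phi,
      s ^+ m.+2 / (1 - u ^+ 2) = \det (Sigma m.+2 u s).
    by near=> u; rewrite det_Sigma //; near: u.
  apply: (near_eq_is_derive eq_det).
  have dnum : is_derive phi 1 (fun u => 1 - u ^+ 2) (- (2 * phi)).
    by apply: is_derive_eq; rewrite /GRing.scale /=; ring.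
  have dinv := @is_derive_inv (fun u => 1 - u ^+ 2) _ _ nz dnum.
  by apply: is_derive_eq; rewrite /GRing.scale /=; ring.
have dquad : is_derive phi 1 (fun u => quad_Sigma x u s)
    (s^-1 * (2 * phi * inner m (obs x) - 2 * lag1 m (obs x))).
  have eq_quad : \forall u \near phi,
      s^-1 * quad m (obs x) u = quad_Sigma x u s.
    by near=> u; rewrite quad_SigmaE //; near: u.
  apply: (near_eq_is_derive eq_quad).
  by rewrite /quad; apply: is_derive_eq; rewrite /GRing.scale /=; ring.
rewrite /score_phi /dlog !derive1E !derive_val det_Sigma //.
congr (_ - _).
have : s ^+ m.+2 != 0 by rewrite expf_neq0.
by move: (s ^+ m.+2) => S S0; field; rewrite S0 nz.
Unshelve. all: by end_near. Qed.

Lemma score_sigma2E phi s : phi ^+ 2 != 1 -> s != 0 ->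
  score_sigma2 x phi s = - (m.+2%:R / s) + quad m (obs x) phi / s ^+ 2.
Proof.
move=> phi1 s0; have nz : 1 - phi ^+ 2 != 0 by rewrite subr_eq0 eq_sym.
have near0 := near_neq0 s0.
have ddet : is_derive s 1 (fun u => \det (Sigma m.+2 phi u))
    (m.+2%:R * s ^+ m.+1 / (1 - phi ^+ 2)).
  have eq_det : \forall u \near s,
      u ^+ m.+2 / (1 - phi ^+ 2) = \det (Sigma m.+2 phi u).
    by near=> u; rewrite det_Sigma //; near: u.
  apply: (near_eq_is_derive eq_det).
  have dpow : is_derive s 1 (fun u => u ^+ m.+2) (m.+2%:R * s ^+ m.+1).
    by split; [exact: exprn_derivable|rewrite exp_derive [LHS]mulr1].
  by apply: is_derive_eq; rewrite /GRing.scale /=; ring.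
have dquad : is_derive s 1 (fun u => quad_Sigma x phi u)
    (- s ^- 2 * quad m (obs x) phi).
  have eq_quad : \forall u \near s,
      u^-1 * quad m (obs x) phi = quad_Sigma x phi u.
    by near=> u; rewrite quad_SigmaE //; near: u.
  apply: (near_eq_is_derive eq_quad).
  have dinv := is_derive_inv s0 (is_derive_id _ _).
  by apply: is_derive_eq; rewrite /GRing.scale /=; ring.
rewrite /score_sigma2 /dlog !derive1E !derive_val det_Sigma //.
have S0 : s ^+ m.+1 != 0 by rewrite expf_neq0.
rewrite [s ^+ m.+2]exprS; move: (s ^+ m.+1) S0 => S S0.
by field; rewrite S0 nz s0.
Unshelve. all: by end_near. Qed.

End Score.

(** * Reduction of the likelihood equations to a cubic *)

Section LikelihoodEquations.
Context (K : numFieldType) (m : nat) (x : 'cV[K]_m.+2).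
Implicit Types (phi s : K).
Local Notation y := (obs x).

Definition cubic phi : K :=
  b3 x * phi ^+ 3 + b2 x * phi ^+ 2 + b1 x * phi + b0 x.

Lemma b3E : b3 x = - (m.+1%:R * inner m y).
Proof. by rewrite /b3 -/(inner m y); ring. Qed.

Lemma b2E : b2 x = m%:R * lag1 m y.
Proof. by rewrite /b2 -/(lag1 m y); ring. Qed.

Lemma b1E : b1 x = m.+3%:R * inner m y + ends m y.
Proof. by rewrite /b1 -/(inner m y) -/(ends m y); ring. Qed.

Lemma b0E : b0 x = - (m.+2%:R * lag1 m y).
Proof. by rewrite /b0 mulNr. Qed.

(** In this form the spurious roots are visible: at 1 and -1 only the first term survives, at a zero
    of [quad] only the second. *)
Lemma cubicE phi : cubic phi =
  phi * quad m y phi + m.+2%:R * (phi * inner m y - lag1 m y) * (1 - phi ^+ 2).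
Proof. by rewrite /cubic b3E b2E b1E b0E /quad; ring. Qed.

Lemma likelihood_solutionsE : nondeg m y != 0 ->
  likelihood_solutions x =
  [set th | cubic th.1 = 0 /\ th.2 = sigma2_hat x th.1].
Proof.
rewrite !mulf_eq0 !negb_or -!andbA => /and5P[inner0 quad1 quadN1 dbl _].
have n0 : m.+2%:R != 0 :> K by rewrite pnatr_eq0.
apply/seteqP; split => -[phi s] /=; rewrite cubicE.
  case=> /= phi1 s0; rewrite score_phiE // score_sigma2E // sigma2_hatE //.
  have nz : 1 - phi ^+ 2 != 0 by rewrite subr_eq0 eq_sym.
  move=> ephi es.
  have quadE : quad m y phi = m.+2%:R * s.
    move/(congr1 (fun t => t * s ^+ 2)): es; rewrite mul0r => es.
    by apply/eqP; rewrite -subr_eq0 -es; apply/eqP; field.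
  split; last by rewrite quadE mulKf.
  (* With denominators cleared and [quad] equal to [n * s], multiplying by [n] yields twice the
     cubic. *)
  move/(congr1 (fun t => - (t * (s * (1 - phi ^+ 2))))): ephi.
  rewrite mul0r oppr0 quadE => ephi.
  apply/eqP; rewrite -(mulrI_eq0 _ (@mulfI _ 2 _)) ?pnatr_eq0 //.
  rewrite -(mulr0 (m.+2%:R)) -ephi; apply/eqP; field.
  by rewrite s0 nz.
case=> cub ->.
have phi1 : phi ^+ 2 != 1.
  rewrite sqrf_eq1; apply/negP => /orP[]/eqP ephi; move: cub; rewrite ephi.
    by rewrite expr1n subrr mulr0 addr0 mul1r => /eqP; rewrite (negbTE quad1).
  rewrite sqrrN expr1n subrr mulr0 addr0 mulN1r => /eqP.
  by rewrite oppr_eq0 (negbTE quadN1).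
have nz : 1 - phi ^+ 2 != 0 by rewrite subr_eq0 eq_sym.
(* If [quad] vanished, the cubic would force [lag1 = phi * inner], making [phi] a double root of
   [quad] and contradicting [dbl]. *)
have quad0 : quad m y phi != 0.
  apply: contra dbl => /eqP q0; move: cub; rewrite q0 mulr0 add0r => /eqP.
  rewrite !mulf_eq0 (negbTE n0) (negbTE nz) orbF /= subr_eq0 => /eqP lagE.
  suff : inner m y * quad m y phi = 0.
    move=> <-; rewrite -lagE /quad -lagE; apply/eqP; ring.
  by rewrite q0 mulr0.
have s0 : sigma2_hat x phi != 0 by rewrite sigma2_hatE // mulf_neq0 ?invr_eq0.
split => //=; rewrite ?score_phiE ?score_sigma2E // sigma2_hatE //.
  transitivity (- 2 * cubic phi / ((1 - phi ^+ 2) * quad m y phi)).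
    by rewrite cubicE; field; rewrite quad0 nz -natrD pnatr_eq0.
  by rewrite cubicE cub mulr0 mul0r.
by field; rewrite quad0 -natrD pnatr_eq0.
Qed.

End LikelihoodEquations.

(** * Cardano's formula over the complex numbers *)

Section Cardano.
Context (R : realType).
Local Notation C := R[i].

Lemma omega_sqr : omega R 1 ^+ 2 = omega R 2.
Proof.
rewrite expr2 /omega /=; apply/eqP; rewrite eq_complex; simpc.
rewrite -[_ / 2 * (_ / 2)]expr2 expr_div_n sqr_sqrtr ?ler0n //=.
by apply/andP; split; apply/eqP; field.
Qed.

Lemma omega_sum : 1 + omega R 1 + omega R 1 ^+ 2 = 0.
Proof.
rewrite omega_sqr /omega /=; apply/eqP; rewrite eq_complex; simpc => /=.
by rewrite andbT; apply/eqP; field.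
Qed.

Lemma omegaE (k : 'I_3) : omega R k = omega R 1 ^+ k.
Proof.
by case: k => -[|[|[|//]]] k3; rewrite /= ?expr0 ?expr1 ?omega_sqr.
Qed.

Lemma sum_cube_root_neq1 (w : C) : 1 + w + w ^+ 2 = 0 -> w != 1.
Proof.
move=> w2; apply/eqP => w1; have /eqP : 3 = 0 :> C by rewrite -w2 w1; ring.
by rewrite pnatr_eq0.
Qed.

Context (m : nat) (x : 'cV[C]_m.+2).
Implicit Types (d u v phi : C).

(** The depressed monic cubic has discriminant [- 4 p^3 - 27 q^2], which is 108 times
    [cardano_Delta]; the leading coefficient enters to the fourth power. *)
Lemma cubic_discrE : b3 x != 0 ->
  cubic_discr (b3 x) (b2 x) (b1 x) (b0 x) = 108 * b3 x ^+ 4 * cardano_Delta x.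
Proof.
rewrite /cubic_discr /cardano_Delta /cardano_q /cardano_p => b0.
by field.
Qed.

Lemma cardano_exists : exists d u v, cardano_radicals x d u v.
Proof.
rewrite /cardano_radicals /cardano_Delta.
set p := cardano_p x; set q := cardano_q x.
pose d := sqrtC (- (- (q / 2) ^+ 2 - (p / 3) ^+ 3)).
pose u := 3.-root (- (q / 2) + d).
have d2 : d ^+ 2 = - (- (q / 2) ^+ 2 - (p / 3) ^+ 3) by rewrite sqrtCK.
have u3 : u ^+ 3 = - (q / 2) + d by rewrite rootCK.
have [u0|u0] := eqVneq u 0; last first.
  (* The pairing [u * v = - (p / 3)] dictates [v]; its cube is right because
     [(q / 2) ^+ 2 - d ^+ 2 = - (p / 3) ^+ 3]. *)
  exists d, u, (- (p / 3) / u); split=> //; last by rewrite mulrC divfK.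
  apply: (mulfI (expf_neq0 3 u0)); rewrite -exprMn mulrC divfK // u3.
  transitivity ((q / 2) ^+ 2 - d ^+ 2); last by ring.
  by rewrite d2; ring.
(* Here [u = 0] gives [d = q / 2], hence [p = 0], and any cube root can serve as [v]. *)
exists d, u, (3.-root (- (q / 2) - d)); split=> //; first by rewrite rootCK.
move: u3; rewrite u0 expr0n mul0r => /esym /addr0_eq; rewrite opprK => dE.
have : (p / 3) ^+ 3 = 0.
  move: d2; rewrite -dE => d2.
  by apply: (addrI ((q / 2) ^+ 2)); rewrite {2}d2; ring.
by move=> /eqP; rewrite expf_eq0 => /eqP ->; rewrite oppr0.
Qed.

(** After the shift to [t] this is the factorization of [t^3 - 3 u v t - (u^3 + v^3)] by means of
    the cube roots of unity. *)
Lemma cubic_factor d u v phi : b3 x != 0 -> cardano_radicals x d u v ->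
  cubic x phi = b3 x * \prod_(k < 3) (phi - phi_sol x u v k).
Proof.
move=> b30 [d2 u3 v3 uv].
pose t := phi + b2 x / (3 * b3 x); pose w := omega R 1.
have -> : cubic x phi = b3 x * (t ^+ 3 + cardano_p x * t + cardano_q x).
  by rewrite /cubic /cardano_p /cardano_q /t; field.
congr (_ * _).
have -> : cardano_p x = - 3 * (u * v) by rewrite uv; field.
have -> : cardano_q x = - (u ^+ 3 + v ^+ 3) by rewrite u3 v3; field.
have solE k : phi - phi_sol x u v k = t - (w ^+ k * u + w ^+ (2 * k) * v).
  by rewrite /phi_sol omegaE -exprM mulnC /t -/w; ring.
rewrite !big_ord_recl big_ord0 !solE /= /bump /= mulr1.
have S0 : 1 + w + w ^+ 2 = 0 := omega_sum.
have -> : w ^+ (2 * (1 + (1 + 0))) = w.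
  transitivity (w + w * (w - 1) * (1 + w + w ^+ 2)); first by ring.
  by rewrite S0 mulr0 addr0.
apply/eqP; rewrite -subr_eq0; apply/eqP.
(* The difference of the two sides is an explicit multiple of [1 + w + w ^+ 2], which is zero. *)
transitivity ((t - (u + v)) * (1 + w + w ^+ 2) *
  ((u + v) * t - (w - 1) * (u ^+ 2 + v ^+ 2) - (w ^+ 2 - w + 1) * (u * v))).
  by ring.
by rewrite S0 mulr0 mul0r.
Qed.

(** If distinct cube roots of unity [a] and [b] gave the same root, then [u = - (a + b) * v]. Since
    [- (a + b)] is the third cube root of unity, [u ^+ 3 = v ^+ 3] would follow, so [d] and
    [cardano_Delta] would vanish. *)
Lemma phi_sol_inj d u v : cardano_Delta x != 0 -> cardano_radicals x d u v ->
  injective (phi_sol x u v).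
Proof.
move=> D0 [d2 u3 v3 _]; pose w := omega R 1.
have S0 : 1 + w + w ^+ 2 = 0 := omega_sum.
have w3 : w ^+ 3 = 1.
  transitivity (1 + (w - 1) * (1 + w + w ^+ 2)); first by ring.
  by rewrite S0 mulr0 addr0.
have neq z : z ^+ 3 = 1 -> u != z * v.
  move=> z3; apply: contra D0 => /eqP uE; rewrite -oppr_eq0 -d2 expf_eq0 /=.
  have /eqP : d *+ 2 = u ^+ 3 - v ^+ 3 by rewrite u3 v3 mulr2n; ring.
  by rewrite uE exprMn z3 mul1r subrr mulrn_eq0.
have root_inj a b : a ^+ 3 = 1 -> b ^+ 3 = 1 ->
    a * u + a ^+ 2 * v = b * u + b ^+ 2 * v -> a = b.
  move=> a3 b3 /eqP; rewrite -subr_eq0.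
  have -> : a * u + a ^+ 2 * v - (b * u + b ^+ 2 * v) =
      (a - b) * (u - - (a + b) * v) by ring.
  have [//|ab] := eqVneq a b; rewrite mulf_eq0 !subr_eq0 (negbTE ab) /=.
  rewrite (negbTE (neq _ _)) //.
  have ab2 : a ^+ 2 + a * b + b ^+ 2 = 0.
    move: ab; rewrite -subr_eq0 => ab; apply: (mulfI ab).
    by rewrite mulr0 -[RHS](subrr 1) -{1}a3 -b3; ring.
  transitivity (2 * a ^+ 3 - b ^+ 3
      - (3 * a) * (a ^+ 2 + a * b + b ^+ 2)); first by ring.
  by rewrite a3 b3 ab2; ring.
have w1 : w != 1 := sum_cube_root_neq1 S0.
have wX k : (0 < k < 3)%N -> w ^+ k != 1.
  case: k => [|[|[|]]] // _; apply: contra w1 => /eqP w2.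
  by rewrite -w3 exprSr w2 mul1r.
have cube k : (w ^+ k) ^+ 3 = 1 by rewrite exprAC w3 expr1n.
move=> i j /addrI; rewrite !(omegaE i) !(omegaE j) -/w => /root_inj.
move=> /(_ (cube _) (cube _)); wlog ij : i j / (i <= j)%N => [wlg E|].
  by case/orP: (leq_total i j) => /wlg; [|move=> /(_ (esym E))]; auto.
rewrite -(subnKC ij) exprD -[LHS]mulr1 => /mulfI.
have w0 : w ^+ i != 0.
  by apply/eqP => wi; move/eqP: (cube i); rewrite wi expr0n eq_sym oner_eq0.
move=> /(_ w0) /esym /eqP; have [ijE _|ij0] := posnP (j - i)%N.
  by apply/val_inj => /=; lia.
by rewrite (negbTE (wX _ _)) //; have := ltn_ord j; lia.
Qed.

End Cardano.

(** * Genericity of the nondegeneracy condition *)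

(** Applied both to evaluation of polynomials and to the embedding of the reals into the complex
    numbers. *)
Lemma rmorph_nondeg (A B : comNzRingType) (f : {rmorphism A -> B}) (m : nat)
    (y : nat -> A) :
  f (nondeg m y) = nondeg m (f \o y).
Proof.
have fends : f (ends m y) = ends m (f \o y) by rewrite rmorphD !rmorphXn.
have finner : f (inner m y) = inner m (f \o y).
  by rewrite rmorph_sum; apply: eq_bigr => i _; rewrite rmorphXn.
have flag1 : f (lag1 m y) = lag1 m (f \o y).
  by rewrite rmorph_sum; apply: eq_bigr => i _; rewrite rmorphM.
rewrite /nondeg /cubic_discr /quad -fends -finner -flag1.
by ring.
Qed.

(** On the second unit vector [ends] and [lag1] vanish and [inner] is 1; [0 < m] makes index 2 an
    inner one. *)
Lemma nondeg_pred1 (R : numDomainType) (m : nat) (y : nat -> R) : (0 < m)%N ->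
  y 2%N = 1 -> (forall k, (0 < k)%N -> k != 2%N -> y k = 0) -> nondeg m y != 0.
Proof.
move=> m0 y2 yE.
have -> : nondeg m y = 16 * m.+1%:R * m.+3%:R ^+ 3.
  rewrite /nondeg /cubic_discr /quad.
  have -> : ends m y = 0 by rewrite /ends !yE ?expr0n ?addr0 //; lia.
  have -> : lag1 m y = 0.
    rewrite /lag1 big_nat_cond big1 // => i /andP[/andP[i1 _] _].
    by have [->|i2] := eqVneq i 2%N; rewrite ?(yE 3) ?(yE i) ?mulr0 ?mul0r.
  have -> : inner m y = 1.
    rewrite /inner big_ltn ?ltnS // y2 expr1n big_nat_cond big1 ?addr0 //.
    by move=> i /andP[/andP[i1 _] _]; rewrite yE ?expr0n //; lia.
  by ring.
by rewrite !mulf_neq0 ?expf_neq0 ?pnatr_eq0.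
Qed.

Lemma generic_nondeg (R : realType) (m : nat) : (0 < m)%N ->
  generic (fun x : 'cV[R]_m.+2 => nondeg m (obs (complexify x)) != 0).
Proof.
(* [Y] is the sample of indeterminates, with the same index shift and default 0 as [obs]. *)
move=> m0; pose Y k : mpoly.mpoly m.+2 R :=
  oapp (fun i => mpoly.mpolyX R (mpoly.mnm1 i)) 0 (insub k.-1).
have evalY (x : 'cV[R]_m.+2) :
    mpoly.meval (fun i => x i 0) (nondeg m Y) = nondeg m (obs x).
  rewrite rmorph_nondeg; congr (nondeg m _); apply/funext => k /=.
  by rewrite /Y /obs; case: insub => [i|] /=; rewrite ?mpoly.mevalXU ?rmorph0.
exists (nondeg m Y).
  pose e : 'cV[R]_m.+2 := \col_i (i == 1%N :> nat)%:R.
  have : nondeg m (obs e) != 0.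
    apply: nondeg_pred1 => //.
      by rewrite /obs insubT /= mxE.
    move=> k k0 k2; rewrite /obs; case: insubP => //= i _ ik.
    by rewrite mxE ik (_ : (_ == _) = false) //; lia.
  by apply: contra => /eqP Y0; rewrite -evalY Y0 rmorph0.
move=> x; rewrite evalY => nz.
have -> : obs (complexify x) = @real_complex R \o obs x.
  apply/funext => k /=; rewrite /obs; case: insub => [i|] /=; rewrite ?mxE //.
by rewrite -rmorph_nondeg fmorph_eq0.
Qed.

Lemma generic_impl (R : realType) (n : nat) (P Q : 'cV[R]_n -> Prop) :
  (forall x, P x -> Q x) -> generic P -> generic Q.
Proof. by move=> PQ [g g0 gP]; exists g => // x /gP /PQ. Qed.

(** * The solution set in Cardano form and its cardinality *)

Lemma likelihood_solutions_cardano (R : realType) (m : nat)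
    (x : 'cV[R[i]]_m.+2) (d u v : R[i]) :
  nondeg m (obs x) != 0 -> cardano_radicals x d u v ->
  injective (phi_sol x u v) /\
  likelihood_solutions x =
    [set (phi_sol x u v k, sigma2_hat x (phi_sol x u v k))
      | k in [set: 'I_3]].
Proof.
move=> nz rad; have := nz; rewrite !mulf_eq0 !negb_or -!andbA.
move=> /and5P[inner0 _ _ _]; rewrite -b3E -b2E -b1E -b0E => discr0.
have b30 : b3 x != 0 by rewrite b3E oppr_eq0 mulf_neq0 ?pnatr_eq0.
split.
  apply: phi_sol_inj rad; apply: contra discr0 => /eqP D0.
  by rewrite cubic_discrE // D0 mulr0.
rewrite likelihood_solutionsE //; apply/seteqP; split => -[phi s] /=.
  move=> [/eqP]; rewrite (cubic_factor _ b30 rad) mulf_eq0 (negbTE b30) /=.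
  move=> /prodf_eq0[k _]; rewrite subr_eq0 => /eqP -> ->.
  by exists k.
move=> [k _ [<- <-]]; split=> //.
by rewrite (cubic_factor _ b30 rad) (bigD1 k) //= subrr mul0r mulr0.
Qed.

Theorem theorem6p3 (R : realType) (n : nat) (hn : (2 < n)%N) :
  AR1_ml_degree_is R n 3 /\
  generic (fun x0 : 'cV[R]_n =>
    let x : 'cV[R[i]]_n := complexify x0 in
    (exists d u v : R[i], cardano_radicals x d u v) /\
    (forall d u v : R[i], cardano_radicals x d u v ->
       likelihood_solutions x =
       [set (phi_sol x u v k, sigma2_hat x (phi_sol x u v k))
         | k in [set: 'I_3]])).
Proof.
case: n hn => [|[|m]] // m0; split.
  apply: generic_impl (generic_nondeg R m0) => x nz.
  have [d [u [v rad]]] := cardano_exists (complexify x).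
  have [inj ->] := likelihood_solutions_cardano nz rad.
  apply: card_eq_trans (card_esym (card_II)).
  (* The first coordinates already tell the solutions apart. *)
  apply: inj_card_eq => k l _ _ [+ _]; exact: inj.
apply: generic_impl (generic_nondeg R m0) => x nz /=.
split; first exact: cardano_exists.
by move=> d u v /(likelihood_solutions_cardano nz)[].
Qed.
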